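(* Let $f:\mathbb{R}\to\mathbb{R}$ be a bounded, locally integrable function with a (non-removable) jump discontinuity at $t\in\mathbb{R}\setminus\{0\}$, and let $\alpha\in\mathbb{R}$. Let $\chi:\mathbb{R}\to\mathbb{R}$ be a kernel such that $\chi(x)=0$ for every $x\in(0,1)$. Then the following assertions are equivalent: (i) $\displaystyle\lim_{w\to+\infty,\ wt\notin\mathbb{Z}}(S_wf)(t)=\alpha\,f(t+0)+(1-\alpha)\,f(t-0)$; (ii) $\Psi^-_\chi(x)=\alpha$ for every $x\in(0,1)$; (iii) $\Psi^+_\chi(x)=1-\alpha$ for every $x\in(0,1)$.
   Context: A function $\chi:\mathbb{R}\to\mathbb{R}$ is called a kernel if: (1) $\chi\in L^1(\mathbb{R})$ and $\chi$ is bounded on $[-1,1]$; (2) $\sum_{k\in\mathbb{Z}}\chi(u-k)=1$ for every $u\in\mathbb{R}$; (3) for some $\beta>0$, $m_\beta(\chi):=\sup_{u\in\mathbb{R}}\sum_{k\in\mathbb{Z}}|\chi(u-k)|\,|u-k|^\beta<+\infty$. For a kernel $\chi$ and $w>0$, the sampling Kantorovich operator is $(S_wf)(t):=\sum_{k\in\mathbb{Z}}\chi(wt-k)\left[w\int_{k/w}^{(k+1)/w}f(u)\,du\right]$, $t\in\mathbb{R}$, for locally integrable $f:\mathbb{R}\to\mathbb{R}$ such that the series converges for each $t\in\mathbb{R}$ (this holds for bounded measurable $f$). Notation: $f(t\pm0):=\lim_{\varepsilon\to0^+}f(t\pm\varepsilon)$; a (non-removable) jump discontinuity at $t$ means that both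 limits $f(t+0)$, $f(t-0)$ exist and are finite and $f(t+0)\neq f(t-0)$. For $x\in\mathbb{R}$, $\Psi^+_\chi(x):=\sum_{k\in\mathbb{Z},\,k<x}\chi(x-k)$ and $\Psi^-_\chi(x):=\sum_{k\in\mathbb{Z},\,k>x}\chi(x-k)$. The limit in (i) is taken as $w\to+\infty$ along those $w>0$ with $wt\notin\mathbb{Z}$. *)

(* Defs.v *)
From mathcomp Require Import all_boot all_order all_algebra.
From mathcomp Require Import all_classical all_reals all_analysis.

Set Implicit Arguments.
Unset Strict Implicit.
Unset Printing Implicit Defensive.

Import Order.TTheory GRing.Theory Num.Theory.
Import numFieldNormedType.Exports.

Local Open Scope classical_set_scope.
Local Open Scope ring_scope.

(* All measurability and integrability notions refer to the Lebesgue (that is,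
   completed Borel) sigma-algebra; [integrable], [measurable_fun] and the
   integrals below read functions on [R] as functions on the carrier of the
   complete measure space, which is convertible to [R]. *)
Definition lebesgueR (R : realType) : measurableType _ :=
  caratheodory_type (wlength (@idfun R))^*%mu.

Definition lebesgueM (R : realType) : {measure set (lebesgueR R) -> \bar R} :=
  @completed_lebesgue_measure R.

(* Counterpart of [locally_integrable setT] for Lebesgue-measurable functions. *)
Definition lebesgue_locally_integrable (R : realType) (f : R -> R) : Prop :=
  measurable_fun [set: lebesgueR R] (f : lebesgueR R -> R) /\
  forall K : set R, compact K ->
    (\int[lebesgueM R]_(x in K) `|f x|%:E < +oo)%E.

(* A series over the integers is split as k = 0, 1, 2, ... and
   k = -1, -2, -3, ...; it converges when both halves do. *)
Definition seriesZ_pos (R : realType) (a : int -> R) : R^nat :=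
  series (fun n : nat => a n%:Z).

Definition seriesZ_neg (R : realType) (a : int -> R) : R^nat :=
  series (fun n : nat => a (- n.+1%:Z)).

Definition cvg_seriesZ (R : realType) (a : int -> R) : Prop :=
  cvgn (seriesZ_pos a) /\ cvgn (seriesZ_neg a).

Definition sumZ (R : realType) (a : int -> R) : R :=
  limn (seriesZ_pos a) + limn (seriesZ_neg a).

Definition abs_moment (R : realType) (chi : R -> R) (beta : R) : \bar R :=
  ereal_sup [set (\esum_(k in [set: int])
                    (`|chi (u - k%:~R)| * `|u - k%:~R| `^ beta)%:E)%E
            | u in [set: R]].

Definition is_kernel (R : realType) (chi : R -> R) : Prop :=
  [/\ (lebesgueM R).-integrable [set: lebesgueR R] (fun x => (chi x)%:E),
      [bounded chi x | x in `[-1, 1]],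
      forall u : R, cvg_seriesZ (fun k => chi (u - k%:~R)) /\
                    sumZ (fun k => chi (u - k%:~R)) = 1
    & exists2 beta : R, 0 < beta & (abs_moment chi beta < +oo)%E].

Definition sampling_kantorovich (R : realType) (chi : R -> R) (w : R)
    (f : R -> R) (t : R) : R :=
  sumZ (fun k : int => chi (w * t - k%:~R) *
    (w * \int[lebesgueM R]_(u in `[k%:~R / w, (k + 1)%:~R / w]) f u)).

Definition right_limit (R : realType) (f : R -> R) (t : R) : R :=
  lim (f x @[x --> t^'+]).

Definition left_limit (R : realType) (f : R -> R) (t : R) : R :=
  lim (f x @[x --> t^'-]).

Definition jump_discontinuity (R : realType) (f : R -> R) (t : R) : Prop :=
  [/\ cvg (f x @[x --> t^'+]), cvg (f x @[x --> t^'-])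
    & right_limit f t != left_limit f t].

Definition Psi_plus (R : realType) (chi : R -> R) (x : R) : R :=
  sumZ (fun k : int => if k%:~R < x then chi (x - k%:~R) else 0).

Definition Psi_minus (R : realType) (chi : R -> R) (x : R) : R :=
  sumZ (fun k : int => if x < k%:~R then chi (x - k%:~R) else 0).

(* Main.v *)
(* Since chi vanishes on (0, 1), the average of f over the interval
   [k/w, (k+1)/w] containing t has weight zero: every other average lies
   strictly on one side of t.  The averages at distance at most d from t are
   close to the corresponding one-sided limit, while the others carry a total
   weight O((wd)^-beta) by the moment condition.  Hence
   S_w f(t) - Psi^-(wt) f(t+0) - Psi^+(wt) f(t-0) tends to 0.  As Psi^- is
   1-periodic, Psi^+ = 1 - Psi^- off the integers, and t != 0 lets wt reach
   every x + n with n of the sign of t, the limit exists with weight alpha iff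
   Psi^- = alpha on (0, 1). *)
Require Import Defs.
From mathcomp Require Import all_boot all_order all_algebra.
From mathcomp Require Import all_classical all_reals all_analysis.
From mathcomp Require Import zify ring lra.

Set Implicit Arguments.
Unset Strict Implicit.

Import Order.TTheory GRing.Theory Num.Theory.
Import numFieldNormedType.Exports.

Local Open Scope classical_set_scope.
Local Open Scope ring_scope.

(** * Absolutely summable series over the integers *)

Lemma normed_series_bounded (R : realType) (u : R^nat) (C : R) :
  (forall N, \sum_(0 <= n < N) `|u n| <= C) ->
  cvgn (series u) /\ `|limn (series u)| <= C.
Proof.
move=> uC.
have cu : cvgn [normed series u].
  apply: nondecreasing_is_cvgn.
    by move=> n m nm; apply: nondecreasing_series => // i _ _; exact: normr_ge0.
  by exists C => _ [N _ <-]; exact: uC.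
split; first exact: normed_cvg.
apply: le_trans (lim_series_norm cu) _.
by apply: limr_le => //; apply: nearW => N; exact: uC.
Qed.

(** Partial sums of either half run over duplicate-free lists of integers, so [C] bounds each half;
    adding the two halves gives the factor 2. *)
Lemma seriesZ_bounded (R : realType) (a : int -> R) (C : R) :
  (forall s : seq int, uniq s -> \sum_(k <- s) `|a k| <= C) ->
  cvg_seriesZ a /\ `|sumZ a| <= C *+ 2.
Proof.
move=> aC.
have [|cp lp] := @normed_series_bounded R (fun n : nat => a n%:Z) C.
  move=> N; rewrite -(big_map Posz xpredT (fun k => `|a k|)); apply: aC.
  by rewrite map_inj_uniq ?iota_uniq// => m n [].
have [|cn ln] := @normed_series_bounded R (fun n : nat => a (- n.+1%:Z)) C.
  move=> N; rewrite -(big_map (fun n : nat => - n.+1%:Z) xpredT (fun k => `|a k|)).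
  by apply: aC; rewrite map_inj_uniq ?iota_uniq// => m n /eqP; rewrite eqr_opp => /eqP[].
by split=> //; rewrite mulr2n (le_trans (ler_normD _ _))// lerD.
Qed.

Lemma cvg_seriesZ_restrict (R : realType) (a : int -> R) (C : R) (P : pred int) :
  (forall s : seq int, uniq s -> \sum_(k <- s) `|a k| <= C) ->
  cvg_seriesZ (fun k => if P k then a k else 0).
Proof.
move=> aC; apply: (proj1 (@seriesZ_bounded R _ C _)) => s us.
apply: le_trans (aC s us); apply: ler_sum => k _.
by case: ifP => // _; rewrite normr0.
Qed.

Lemma seriesZ_linear (R : realType) (x y : R) (a b : int -> R) :
  cvg_seriesZ a -> cvg_seriesZ b ->
  cvg_seriesZ (fun k => x * a k + y * b k) /\
  sumZ (fun k => x * a k + y * b k) = x * sumZ a + y * sumZ b.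
Proof.
move=> [ap an] [bp bn].
have lin (u v : R^nat) : cvgn (series u) -> cvgn (series v) ->
    series (fun n => x * u n + y * v n) @ \oo -->
      x * limn (series u) + y * limn (series v).
  move=> cu cv.
  have -> : series (fun n => x * u n + y * v n) =
      (fun n => x * series u n + y * series v n).
    by apply/funext => n; rewrite /series/= big_split/= -!mulr_sumr.
  by apply: cvgD; apply: cvgMr.
split; first by split; apply/cvg_ex; eexists; apply: lin.
rewrite /sumZ /seriesZ_pos /seriesZ_neg (cvg_lim _ (lin _ _ ap bp))//.
by rewrite (cvg_lim _ (lin _ _ an bn))//; ring.
Qed.

(** The shift moves the single term [a 0] from the nonnegative half to the negative half. At a
    finite stage the negative half also lacks its last term [a (- n)], which tends to 0. *)
Lemma seriesZ_shift (R : realType) (a : int -> R) :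
  cvg_seriesZ a ->
  cvg_seriesZ (fun k => a (k + 1)) /\ sumZ (fun k => a (k + 1)) = sumZ a.
Proof.
move=> [ap an].
have pE : seriesZ_pos (fun k => a (k + 1)) =
    (fun n => seriesZ_pos a n.+1 - a 0).
  apply/funext => n; rewrite /seriesZ_pos /series/= big_nat_recl//= addrC addKr.
  by apply: eq_bigr => i _; rewrite -addn1 PoszD.
have nE : seriesZ_neg (fun k => a (k + 1)) =
    (fun n => a 0 - a (- n%:Z) + seriesZ_neg a n).
  apply/funext; elim=> [|n IH]; rewrite /seriesZ_neg /series/=.
    by rewrite !big_nil subrr addr0.
  move: IH; rewrite /seriesZ_neg /series/= !big_nat_recr//= => ->.
  by rewrite (_ : - n.+1%:Z + 1 = - n%:Z); [ring | lia].
have a0 : a (- n%:Z) @[n --> \oo] --> 0.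
  rewrite -(cvg_shiftS (fun n : nat => a (- n%:Z))).
  exact: cvg_series_cvg_0 an.
have lp : seriesZ_pos (fun k => a (k + 1)) @ \oo --> limn (seriesZ_pos a) - a 0.
  rewrite pE; apply: cvgB; last exact: cvg_cst.
  by rewrite (cvg_shiftS (seriesZ_pos a)).
have ln : seriesZ_neg (fun k => a (k + 1)) @ \oo -->
    a 0 - 0 + limn (seriesZ_neg a).
  by rewrite nE; apply: cvgD => //; apply: cvgB => //; exact: cvg_cst.
split; first by split; apply/cvg_ex; eexists; [exact: lp | exact: ln].
by rewrite /sumZ (cvg_lim _ lp)// (cvg_lim _ ln)//; ring.
Qed.

(** * Averages over intervals for the completed Lebesgue measure *)

Lemma measurable_lebesgueR_itvcc (R : realType) (x y : R) :
  measurable (`[x, y]%classic : set (lebesgueR R)).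
Proof.
apply: (@sub_caratheodory _ _ _ (wlength idfun)).
exact: (@measurable_itv R (Interval (BLeft x) (BRight y))).
Qed.

(** The completed measure and [lebesgue_measure] come from the same outer measure, so the known
    length of an interval transfers by conversion. *)
Lemma lebesgueM_itvcc (R : realType) (x y : R) : x <= y ->
  lebesgueM R (`[x, y]%classic : set (lebesgueR R)) = (y - x)%:E.
Proof.
move=> xy.
have := @lebesgue_measure_itv R (Interval (BLeft x) (BRight y)).
rewrite /= lte_fin.
case: ifPn => [_|]; first by move=> H; exact: H.
rewrite -leNgt => yx H.
have yxE : y - x = 0 by apply/eqP; rewrite subr_eq0 eq_le xy yx.
by rewrite yxE; exact: H.
Qed.

(** A constant is its own average, so the left-hand side is the average of [f - c], bounded
    pointwise by [e]. *)
Lemma Rintegral_average_bound (R : realType) (f : R -> R) (x y c e : R) :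
  x < y -> bounded_fun f ->
  measurable_fun [set: lebesgueR R] (f : lebesgueR R -> R) ->
  (forall u, u \in `[x, y] -> `|f u - c| <= e) ->
  `|(y - x)^-1 * \int[lebesgueM R]_(u in `[x, y]) f u - c| <= e.
Proof.
move=> xy bf mf fc.
set D : set (lebesgueR R) := `[x, y]%classic.
have mD : measurable D by exact: measurable_lebesgueR_itvcc.
have muD : lebesgueM R D = (y - x)%:E by apply: lebesgueM_itvcc; exact: ltW.
have foo : (lebesgueM R D < +oo)%E by rewrite muD ltry.
have intf : (lebesgueM R).-integrable D (EFin \o (f : lebesgueR R -> R)).
  apply: measurable_bounded_integrable => //.
    exact: measurable_funS mf.
  by move: bf; apply: sub_boundedr => A hA u _; exact: hA.
have intc (r : R) : (lebesgueM R).-integrable D (EFin \o (fun=> r)).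
  by apply: measurable_bounded_integrable => //; exact: bounded_cst.
have xy0 : 0 < y - x by rewrite subr_gt0.
have -> : (y - x)^-1 * \int[lebesgueM R]_(u in D) f u - c =
    (y - x)^-1 * \int[lebesgueM R]_(u in D) (f u - c).
  rewrite RintegralB// Rintegral_cst// muD/= mulrBr [c * _]mulrC mulKf//.
  by rewrite gt_eqF.
have intB : (lebesgueM R).-integrable D (EFin \o (fun u => f u - c)).
  have := integrableB mD intf (intc c).
  by apply: eq_integrable.
rewrite normrM gtr0_norm ?invr_gt0// ler_pdivrMl//.
apply: le_trans (le_normr_Rintegral mD intB) _.
rewrite -[leRHS]mulrC -[y - x]/(fine (y - x)%:E) -muD -Rintegral_cst//.
apply: le_Rintegral => //.
exact: integrable_norm intB.
Qed.

(** * Uniform bounds on finite sums of kernel values *)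

Lemma sum_uniq_le_esum (R : realType) (T : choiceType) (a : T -> R) (s : seq T) :
  uniq s -> ((\sum_(k <- s) a k)%:E <= \esum_(k in [set: T]) (a k)%:E)%E.
Proof.
move=> us; apply: esum_ge; exists [set` s]; first by split.
by rewrite -fsbig_seq// sumEFin.
Qed.

Lemma abs_moment_bound (R : realType) (chi : R -> R) (beta : R) :
  (abs_moment chi beta < +oo)%E ->
  exists C : R, forall (u : R) (s : seq int), uniq s ->
    \sum_(k <- s) `|chi (u - k%:~R)| * `|u - k%:~R| `^ beta <= C.
Proof.
move=> moo; exists (fine (abs_moment chi beta)) => u s us.
have le_m : ((\sum_(k <- s) `|chi (u - k%:~R)| * `|u - k%:~R| `^ beta)%:E
    <= abs_moment chi beta)%E.
  apply: (le_trans (@sum_uniq_le_esum R int _ s us)).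
  by apply: ereal_sup_ubound; exists u.
(* Besides [+oo], the value [-oo] must be excluded before [fine] can be undone; [le_m] does this. *)
rewrite -lee_fin fineK// fin_numE -ltey moo andbT.
by rewrite -ltNye (lt_le_trans _ le_m)// ltNyr.
Qed.

(** With [f] the floor of [u], the only candidates are [f - 1], [f] and [f + 1]. *)
Lemma count_near_int (R : realType) (u : R) (s : seq int) : uniq s ->
  (count (fun k => `|u - k%:~R| <= 1)%R s <= 3)%N.
Proof.
move=> us; pose f := Num.floor u.
rewrite -size_filter.
apply: (@uniq_leq_size _ _ [:: f - 1; f; f + 1]); first exact: filter_uniq.
move=> k; rewrite mem_filter ler_norml => /andP[/andP[uk1 uk2] _].
have /andP[] := floor_itv u; rewrite -/f intrD => fu uf.
have k1 : f - 1 <= k by rewrite -(ler_int R) intrD; lra.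
have k2 : k < f + 1 + 1 by rewrite -(ltr_int R) !intrD; lra.
by rewrite !inE; lia.
Qed.

Lemma bounded_onP (T : Type) (R : realType) (g : T -> R) (A : set T) :
  [bounded g x | x in A] -> exists2 M : R, 0 <= M & forall x, A x -> `|g x| <= M.
Proof.
(* Boundedness only provides bounds strictly above [M], hence [M + 1]; the maximum with 0 makes the
   bound nonnegative. *)
move=> [M [_ HM]]; exists (Num.max 0 (M + 1)); first by rewrite le_max lexx.
by move=> x Ax; apply: HM Ax => /=; rewrite lt_max ltrDl ltr01 orbT.
Qed.

(** At most three integers lie within 1 of [u], and boundedness on [-1, 1] controls their terms. For
    the others [|u - k| ^ beta] exceeds 1, so the moment of order [beta] dominates. *)
Lemma kernel_abs_sum_bound (R : realType) (chi : R -> R) : is_kernel chi ->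
  exists C : R, forall (u : R) (s : seq int), uniq s ->
    \sum_(k <- s) `|chi (u - k%:~R)| <= C.
Proof.
move=> [_ /bounded_onP[B B0 chiB] _ [beta beta0 /abs_moment_bound[C HC]]].
exists (B * 3%:R + C) => u s us.
apply: (@le_trans _ _ (\sum_(k <- s) (B * (`|u - k%:~R| <= 1)%R%:R +
    `|chi (u - k%:~R)| * `|u - k%:~R| `^ beta))).
  apply: ler_sum => k _; case: (lerP `|u - k%:~R| 1) => uk.
    rewrite mulr1 -[leLHS]addr0 lerD// ?mulr_ge0 ?powR_ge0//.
    by apply: chiB; rewrite /= in_itv/= -ler_norml.
  rewrite mulr0 add0r ler_peMr//.
  have : 1 `^ beta <= `|u - k%:~R| `^ beta.
    by apply: ge0_ler_powR; rewrite ?nnegrE//; exact: ltW.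
  by rewrite powR1.
rewrite big_split/= lerD ?HC// -mulr_sumr ler_wpM2l//.
rewrite -natr_sum ler_nat; apply: leq_trans (count_near_int u us).
by rewrite -sum1_count [leqRHS]big_mkcond; apply: leq_sum => k _; case: ifP.
Qed.

(** * Periodicity, and the quantitative estimate at a jump *)

(** A unit translation is absorbed by the index shift [k + 1]; iterating it, forwards or backwards,
    yields every integer. *)
Lemma Psi_minus_shift (R : realType) (chi : R -> R) (x : R) (n : int) :
  is_kernel chi -> Psi_minus chi (x + n%:~R) = Psi_minus chi x.
Proof.
move=> /kernel_abs_sum_bound[C HC].
have step y : Psi_minus chi (y + 1) = Psi_minus chi y.
  pose a (k : int) := if y + 1 < k%:~R then chi (y + 1 - k%:~R) else 0.
  have ca : cvg_seriesZ a := cvg_seriesZ_restrict _ (HC (y + 1)).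
  rewrite -[LHS](proj2 (seriesZ_shift ca)); congr sumZ; apply/funext => k.
  by rewrite /a intrD ltrD2r opprD addrACA subrr addr0.
have stepn m y : Psi_minus chi (y + m%:R) = Psi_minus chi y.
  by elim: m => [|m IH]; rewrite ?addr0// -natr1 addrA step.
case: n => m; first exact: stepn.
by rewrite NegzE intrN -(stepn m.+1 (x - _)) subrK.
Qed.

(** The term [e * m0] pays for averages near [t]; the term with [mb] is a Markov-type bound on the
    terms beyond [w * d]. The doubling comes from [seriesZ_bounded]. *)
Lemma sampling_kantorovich_jump_bound (R : realType) (f chi : R -> R)
    (beta m0 mb t w d e M fr fl : R) :
  (forall x : R, 0 < x < 1 -> chi x = 0) ->
  0 < beta -> 0 <= e ->
  (forall (u : R) (s : seq int), uniq s -> \sum_(k <- s) `|chi (u - k%:~R)| <= m0) ->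
  (forall (u : R) (s : seq int), uniq s ->
    \sum_(k <- s) `|chi (u - k%:~R)| * `|u - k%:~R| `^ beta <= mb) ->
  measurable_fun [set: lebesgueR R] (f : lebesgueR R -> R) ->
  (forall u, `|f u| <= M) -> `|fr| <= M -> `|fl| <= M ->
  0 < d -> d^-1 <= w -> w * t \isn't a Num.int ->
  (forall u, t < u <= t + 2 * d -> `|f u - fr| <= e) ->
  (forall u, t - 2 * d <= u < t -> `|f u - fl| <= e) ->
  `|sampling_kantorovich chi w f t -
    (fr * Psi_minus chi (w * t) + fl * Psi_plus chi (w * t))| <=
  (e * m0 + 2 * M * (w * d) `^ (- beta) * mb) *+ 2.
Proof.
move=> chi0 beta0 e0 Hm0 Hmb mf fM frM flM d0 dw wtZ fr_near fl_near.
have w0 : 0 < w by rewrite (lt_le_trans _ dw)// invr_gt0.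
have wd0 : 0 < w * d by rewrite mulr_gt0.
have M0 : 0 <= M by rewrite (le_trans _ frM).
have m0_ge0 : 0 <= m0 by have := Hm0 0 [::] isT; rewrite big_nil.
have bf : bounded_fun f.
  exists M; split; first exact: num_real.
  by move=> N MN u _ /=; rewrite (le_trans (fM u))// ltW.
pose avg (k : int) := w * \int[lebesgueM R]_(u in `[k%:~R / w, (k + 1)%:~R / w]) f u.
have avg_bound c r (k : int) :
    (forall u, k%:~R / w <= u <= (k + 1)%:~R / w -> `|f u - c| <= r) ->
    `|avg k - c| <= r.
  move=> fc; have kw : k%:~R / w < (k + 1)%:~R / w.
    by rewrite ltr_pM2r ?invr_gt0// ltr_int ltzD1.
  (* The factor [w] is the inverse length of the interval, so [avg k] is a genuine average. *)
  have wE : (k + 1)%:~R / w - k%:~R / w = w^-1 by rewrite intrD; ring.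
  have := Rintegral_average_bound (c := c) (e := r) kw bf mf.
  rewrite wE invrK; apply => u; rewrite in_itv; exact: fc.
pose rt (k : int) := if w * t < k%:~R then chi (w * t - k%:~R) else 0.
pose lt (k : int) := if k%:~R < w * t then chi (w * t - k%:~R) else 0.
have crt : cvg_seriesZ rt := cvg_seriesZ_restrict _ (Hm0 (w * t)).
have clt : cvg_seriesZ lt := cvg_seriesZ_restrict _ (Hm0 (w * t)).
have cS : cvg_seriesZ (fun k => chi (w * t - k%:~R) * avg k).
  apply: (proj1 (@seriesZ_bounded R _ (m0 * M) _)) => s us.
  apply: le_trans (ler_wpM2r M0 (Hm0 (w * t) s us)).
  rewrite mulr_suml; apply: ler_sum => k _; rewrite normrM ler_wpM2l//.
  rewrite -[avg k]subr0; apply: avg_bound => u _; rewrite subr0; exact: fM.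
have [crl rlE] := seriesZ_linear fr fl crt clt.
(* The difference becomes one series, so that it can be estimated term by term. *)
have [_ SE] := seriesZ_linear 1 (-1) cS crl.
rewrite /Psi_minus /Psi_plus -/rt -/lt -rlE -[sampling_kantorovich _ _ _ _]mul1r -mulN1r.
rewrite -[X in 1 * X]/(sumZ (fun k => chi (w * t - k%:~R) * avg k)) -SE.
apply: (proj2 (@seriesZ_bounded R _ _ _)) => s us.
rewrite [e * _]mulrC.
apply: (@le_trans _ _ (\sum_(k <- s) (`|chi (w * t - k%:~R)| * e +
  2 * M * (w * d) `^ (- beta) *
    (`|chi (w * t - k%:~R)| * `|w * t - k%:~R| `^ beta)))); last first.
  rewrite big_split/= -mulr_suml -mulr_sumr lerD//.
    by rewrite ler_wpM2r// Hm0.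
  by rewrite ler_wpM2l// ?Hmb// !mulr_ge0// powR_ge0.
apply: ler_sum => k _.
(* Far from [t], the crude bound 2M is paid for by the beta-moment. *)
have far c : `|c| <= M -> w * d < `|w * t - k%:~R| ->
    `|chi (w * t - k%:~R) * (avg k - c)| <= `|chi (w * t - k%:~R)| * e +
      2 * M * (w * d) `^ (- beta) *
      (`|chi (w * t - k%:~R)| * `|w * t - k%:~R| `^ beta).
  move=> cM dk.
  rewrite normrM -[leLHS]add0r lerD// ?mulr_ge0//.
  rewrite [leRHS](_ : _ = `|chi (w * t - k%:~R)| * (2 * M *
    ((w * d) `^ (- beta) * `|w * t - k%:~R| `^ beta))); last by ring.
  rewrite ler_wpM2l// (@le_trans _ _ (2 * M))//.
    apply: avg_bound => u _; rewrite (le_trans (ler_normB _ _))//.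
    by rewrite mulr_natl mulr2n lerD.
  rewrite ler_peMr ?mulr_ge0//.
  rewrite powRN mulrC ler_pdivlMr ?powR_gt0// mul1r.
  by apply: ge0_ler_powR; rewrite ?nnegrE//; exact: ltW.
have near c : `|avg k - c| <= e ->
    `|chi (w * t - k%:~R) * (avg k - c)| <= `|chi (w * t - k%:~R)| * e +
      2 * M * (w * d) `^ (- beta) *
      (`|chi (w * t - k%:~R)| * `|w * t - k%:~R| `^ beta).
  move=> ce; rewrite normrM -[leLHS]addr0 lerD// ?ler_wpM2l//.
  by rewrite !mulr_ge0// powR_ge0.
(* An averaging interval whose left endpoint is within [d] of [t] thus stays within [2 * d], the
   radius of the windows in the hypotheses. *)
have w1d : w^-1 <= d by rewrite -[d]invrK lef_pV2 ?posrE ?invr_gt0.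
rewrite /rt /lt.
have /or3P[wtk|kwt|/eqP kwt] :
    [|| w * t < k%:~R, k%:~R < w * t | w * t == k%:~R] by case: ltrgtP.
- rewrite wtk (lt_gtF wtk) mulr0 addr0 mul1r mulN1r [fr * _]mulrC -mulrBr.
  have [dk|kd] := ltP (w * d) `|w * t - k%:~R|; first exact: far.
  apply: near; apply: avg_bound => u /andP[ku uk]; apply: fr_near; apply/andP; split.
    by rewrite (lt_le_trans _ ku)// ltr_pdivlMr// mulrC.
  rewrite (le_trans uk)// intrD mulrDl mul1r.
  have : k%:~R / w <= t + d.
    by rewrite ler_pdivrMr//; move: kd; rewrite ler_norml; nra.
  lra.
- rewrite kwt (lt_gtF kwt) mulr0 add0r mul1r mulN1r [fl * _]mulrC -mulrBr.
  have [dk|kd] := ltP (w * d) `|w * t - k%:~R|; first exact: far.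
  (* If [w * t - k < 1], then [t] is interior to the averaging interval, and the weight vanishes by
     [chi0]. *)
  have [kwt1|kwt1] := ltP (w * t - k%:~R) 1.
    rewrite chi0 ?mul0r ?normr0 ?subr_gt0 ?kwt ?kwt1//.
    by rewrite !mul0r mulr0 addr0.
  apply: near; apply: avg_bound => u /andP[ku uk]; apply: fl_near; apply/andP; split.
    rewrite (le_trans _ ku)// ler_pdivlMr//.
    by move: kd; rewrite ler_norml; nra.
  (* The right endpoint must lie strictly left of [t]; equality would make [w * t] the integer
     [k + 1]. *)
  rewrite (le_lt_trans uk)// ltr_pdivrMr// intrD mulrC lt_neqAle.
  rewrite -lerBrDl kwt1 andbT; apply: contra wtZ => /eqP <-.
  by rewrite -intrD rpred_int.
- by move: wtZ; rewrite kwt rpred_int.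
Qed.

(** * Complementary one-sided sums, the limit at the jump, and the equivalence *)

(** Off the integers no index satisfies [k = x], so the two one-sided sums exhaust the partition of
    unity. *)
Lemma Psi_plusE (R : realType) (chi : R -> R) (x : R) :
  is_kernel chi -> x \isn't a Num.int -> Psi_plus chi x = 1 - Psi_minus chi x.
Proof.
move=> kchi xZ; have [C HC] := kernel_abs_sum_bound kchi.
have [_ _ /(_ x)[_ chi1] _] := kchi.
pose rt (k : int) := if x < k%:~R then chi (x - k%:~R) else 0.
pose lt (k : int) := if k%:~R < x then chi (x - k%:~R) else 0.
have crt : cvg_seriesZ rt := cvg_seriesZ_restrict _ (HC x).
have clt : cvg_seriesZ lt := cvg_seriesZ_restrict _ (HC x).
have [_] := seriesZ_linear 1 1 crt clt.
rewrite [X in sumZ X](_ : _ = fun k => chi (x - k%:~R)).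
  by rewrite chi1 /Psi_plus /Psi_minus -/rt -/lt !mul1r => ->; rewrite addrC addKr.
apply/funext => k; rewrite /rt /lt !mul1r.
case: ltgtP; rewrite ?addr0 ?add0r// => xk.
by move: xZ; rewrite xk rpred_int.
Qed.

Lemma notin_int_itv01 (R : realType) (x : R) : 0 < x < 1 -> x \isn't a Num.int.
Proof.
move=> /andP[x0 x1]; apply/negP => /intrP[m xm].
by move: x0 x1; rewrite xm ltr0z (ltrz1 R); lia.
Qed.

Lemma frac_itv01 (R : realType) (y : R) : y \isn't a Num.int ->
  0 < y - (Num.floor y)%:~R < 1.
Proof.
move=> yZ; have /andP[fy yf] := floor_itv y; apply/andP; split.
  rewrite subr_gt0 lt_neqAle fy andbT.
  by apply: contra yZ => /eqP <-; exact: rpred_int.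
by rewrite ltrBlDl -[X in _ + X]/(1%:~R) -intrD.
Qed.

(** The difference vanishes whether or not [Psi_minus chi (w * t)] converges. The one-sided limits
    fix [d] first; then a large [w] makes the tail small. *)
Lemma sampling_kantorovich_jump_limit (R : realType) (f chi : R -> R) (t : R) :
  bounded_fun f ->
  measurable_fun [set: lebesgueR R] (f : lebesgueR R -> R) ->
  jump_discontinuity f t -> is_kernel chi ->
  (forall x : R, 0 < x < 1 -> chi x = 0) ->
  sampling_kantorovich chi w f t -
    (right_limit f t * Psi_minus chi (w * t) + left_limit f t * Psi_plus chi (w * t))
    @[w --> within [set w : R | w * t \isn't a Num.int] (pinfty_nbhs R)] --> (0 : R).
Proof.
move=> /bounded_onP[M0 M00 fM0] mf [cr cl _] kchi chi0.
have [m0 Hm0] := kernel_abs_sum_bound kchi.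
have [_ _ _ [beta beta0 /abs_moment_bound[mb Hmb]]] := kchi.
set fr := right_limit f t; set fl := left_limit f t.
(* This choice bounds [f] and both one-sided limits at once, without passing the bound on [f] to the
   limit. *)
pose M := M0 + `|fr| + `|fl|.
have m0_ge0 : 0 <= m0 by have := Hm0 0 [::] isT; rewrite big_nil.
have mb_ge0 : 0 <= mb by have := Hmb 0 [::] isT; rewrite big_nil.
have M_ge0 : 0 <= M by rewrite /M !addr_ge0.
have fM u : `|f u| <= M.
  by rewrite (le_trans (fM0 u I))// /M -addrA lerDl addr_ge0.
have frM : `|fr| <= M by rewrite /M addrAC lerDr addr_ge0.
have flM : `|fl| <= M by rewrite /M lerDr addr_ge0.
apply/cvgr0Pnorm_le => eps eps0.
(* With [e] and [eta], each summand of the estimate is at most [eps / 4], hence [eps] at most after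
   doubling. Adding 1 keeps the denominators positive. *)
pose e := eps / (4 * (m0 + 1)).
pose eta := eps / (8 * (M * mb + 1)).
have e0 : 0 < e by rewrite divr_gt0// mulr_gt0// ltr_wpDl.
have eta0 : 0 < eta by rewrite divr_gt0// mulr_gt0// ltr_wpDl// mulr_ge0.
have [dr dr0 Hr] : exists2 d : R, 0 < d &
    forall u, t < u <= t + d -> `|f u - fr| <= e.
  have /cvgrPdist_le/(_ e e0) := cr.
  (* Halving the radius fits the closed endpoint inside the open ball. *)
  move=> /nbhs_ballP[d /= d0 H]; exists (d / 2); first by rewrite divr_gt0.
  move=> u /andP[tu ud]; rewrite distrC; apply: H => //.
  by rewrite /ball/= ltr_norml; apply/andP; split; lra.
have [dl dl0 Hl] : exists2 d : R, 0 < d &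
    forall u, t - d <= u < t -> `|f u - fl| <= e.
  have /cvgrPdist_le/(_ e e0) := cl.
  move=> /nbhs_ballP[d /= d0 H]; exists (d / 2); first by rewrite divr_gt0.
  move=> u /andP[ud tu]; rewrite distrC; apply: H => //.
  by rewrite /ball/= ltr_norml; apply/andP; split; lra.
pose d := Num.min dr dl / 2.
have d0 : 0 < d by rewrite divr_gt0// lt_min dr0 dl0.
have ddr : 2 * d <= dr by rewrite /d mulrCA divff// mulr1 ge_min lexx.
have ddl : 2 * d <= dl by rewrite /d mulrCA divff// mulr1 ge_min lexx orbT.
rewrite near_withinE; near=> w => wtZ.
have dw : d^-1 <= w by near: w; apply: nbhs_pinfty_ge; exact: num_real.
(* This solves [z ^ (- beta) = eta], so [w >= z / d] forces the tail factor below [eta]. *)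
pose z := eta `^ (- beta^-1).
have z0 : 0 < z by rewrite powR_gt0.
have zE : z `^ (- beta) = eta.
  by rewrite -powRrM mulrNN mulVf ?gt_eqF// powRr1// ltW.
have zw : z / d <= w by near: w; apply: nbhs_pinfty_ge; exact: num_real.
have zwd : z <= w * d by rewrite -ler_pdivrMr.
have wd0 : 0 < w * d by exact: lt_le_trans zwd.
have wd_eta : (w * d) `^ (- beta) <= eta.
  rewrite -zE !powRN lef_pV2 ?posrE ?powR_gt0//.
  by apply: ge0_ler_powR; rewrite ?nnegrE//; exact: ltW.
apply: le_trans (@sampling_kantorovich_jump_bound R f chi beta m0 mb t w d e M
  fr fl chi0 beta0 (ltW e0) Hm0 Hmb mf fM frM flM d0 dw wtZ _ _) _.
- by move=> u /andP[tu ud]; apply: Hr; rewrite tu (le_trans ud)// lerD2l.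
- by move=> u /andP[ud tu]; apply: Hl; rewrite tu andbT (le_trans _ ud)// lerB.
have em0 : e * m0 <= eps / 4.
  rewrite /e -mulrA ler_pM2l// invfM -mulrA ler_piMr//.
  by rewrite ler_pdivrMl ?mulr1 ?lerDl// ltr_wpDl.
have etaM : 2 * M * eta * mb <= eps / 4.
  rewrite [leLHS](_ : _ = eps * (4^-1 * ((M * mb + 1)^-1 * (M * mb)))); last first.
    by rewrite /eta; field; rewrite gt_eqF// ltr_wpDl// mulr_ge0.
  rewrite ler_pM2l// ler_piMr// ler_pdivrMl ?mulr1 ?lerDl//.
  by rewrite ltr_wpDl// mulr_ge0.
have : 2 * M * (w * d) `^ (- beta) * mb <= eps / 4.
  apply: le_trans etaM; rewrite ler_wpM2r// ler_wpM2l// mulr_ge0//.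
by rewrite mulr2n; lra.
Unshelve. all: by end_near. Qed.

Theorem theorem2p9 (R : realType) (f chi : R -> R) (t alpha : R)
    (f_bounded : bounded_fun f)
    (f_locint : lebesgue_locally_integrable f)
    (t_neq0 : t != 0)
    (f_jump : jump_discontinuity f t)
    (chi_kernel : is_kernel chi)
    (chi_eq0 : forall x : R, 0 < x < 1 -> chi x = 0) :
  let assertion_i :=
    sampling_kantorovich chi w f t
      @[w --> within [set w : R | w * t \isn't a Num.int] (pinfty_nbhs R)] -->
    alpha * right_limit f t + (1 - alpha) * left_limit f t in
  let assertion_ii := forall x : R, 0 < x < 1 -> Psi_minus chi x = alpha in
  let assertion_iii := forall x : R, 0 < x < 1 -> Psi_plus chi x = 1 - alpha in
  (assertion_i <-> assertion_ii) /\ (assertion_ii <-> assertion_iii).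
Proof.
have S0 := sampling_kantorovich_jump_limit f_bounded f_locint.1 f_jump chi_kernel chi_eq0.
have [_ _ fr_neq_fl] := f_jump.
have FF : Filter (within [set w : R | w * t \isn't a Num.int] (pinfty_nbhs R)).
  exact: within_filter.
split; last first.
  split=> H x x01; have := Psi_plusE chi_kernel (notin_int_itv01 x01).
    by rewrite H.
  by rewrite H// => /addrI/oppr_inj.
split=> [lim_alpha x x01|Psi_alpha].
  (* Subtracting the vanishing difference leaves the convergence of the combination of [Psi_minus]
     and [Psi_plus] alone. *)
  have D0 := cvgB (FF := FF) lim_alpha S0.
  have /eqP : (right_limit f t - left_limit f t) * (Psi_minus chi x - alpha) = 0.
    apply/eqP; rewrite -normr_le0; apply/ler_addgt0Pr => e e0; rewrite add0r.
    have /cvgrPdist_le/(_ e e0) := D0.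
    rewrite subr0 near_withinE => -[W [_ HW]].
    (* The integer [j] pushes [w = x / t + j / |t|] beyond [W], while [w * t = x + j * sgz t]
       remains an integer translate of [x]. The outer absolute value meets the nonnegativity
       condition of [archi_boundP]. *)
    pose j := Num.bound `|(W - x / t) * `|t| |.
    have absW : W - x / t < j%:R / `|t|.
      rewrite ltr_pdivlMr ?normr_gt0//.
      by rewrite (le_lt_trans (ler_norm _))// archi_boundP.
    pose w := x / t + j%:R / `|t|.
    have wt : w * t = x + (j%:Z * sgz t)%:~R.
      rewrite /w mulrDl divfK// intrM -sgrEz {2}[t]numEsg.
      by field; rewrite normr_eq0.
    have wtZ : w * t \isn't a Num.int.
      rewrite wt; apply: contra (notin_int_itv01 x01) => xZ.
      by rewrite -[x](addrK (j%:Z * sgz t)%:~R) rpredB// rpred_int.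
    have := HW w _ wtZ; rewrite /w -ltrBlDl => /(_ absW).
    rewrite !fctE -/w Psi_plusE// wt Psi_minus_shift// distrC.
    by apply: le_trans; rewrite le_eqVlt; apply/orP; left; apply/eqP; congr `| _ |; ring.
  (* The jump is not removable, so its factor cancels. *)
  by rewrite mulf_eq0 subr_eq0 (negbTE fr_neq_fl)/= subr_eq0 => /eqP.
(* Conversely, for every admissible [w] the subtracted combination equals the claimed limit, so
   adding that constant back recovers the operator. *)
have := cvgD (FF := FF) S0 (cvg_cst (FF := FF)
  (alpha * right_limit f t + (1 - alpha) * left_limit f t)).
rewrite add0r; apply: cvg_trans; apply: near_eq_cvg.
rewrite near_withinE; apply: nearW => w wtZ.
have Psiw : Psi_minus chi (w * t) = alpha.
  (* Periodicity reduces [w * t] to its fractional part, which lies in (0, 1) because [w * t] is not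
     an integer. *)
  rewrite -[w * t](subrK (Num.floor (w * t))%:~R) Psi_minus_shift//.
  by apply: Psi_alpha; exact: frac_itv01.
by rewrite !fctE Psi_plusE// Psiw; ring.
Qed.
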